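(* Computing $p_n$ with a sublinear sieve is asymptotically worse than computing it with the binary search algorithm: the running time $\sqrt{n}\,(\log n)^4$ of the binary search algorithm is of strictly smaller order than the running time $\frac{n\log n}{\log\log n}$ of the sublinear sieve, i.e. $$\lim_{n\to\infty}\frac{\sqrt{n}\,(\log n)^4}{\;n\log n/\log\log n\;}=0 .$$
   Context: Here $p_n$ is the $n$th prime, $\log$ is the natural logarithm, and $\pi(x)$ is the number of primes $\le x$. The binary search algorithm finds $p_n$ by binary search with evaluations of $\pi(x)$, each costing $O(\sqrt{x}\,(\log x)^{5/2})$ time, over the interval from $n(\log n+\log\log n-1)$ to $n(\log n+\log\log n)$; its total running time is $O(\sqrt{n}\,(\log n)^4)$. A sublinear sieve produces all primes up to a bound $M$ in $O(M/\log\log M)$ time; applied with $M=n(\log n+\log\log n)$, followed by counting to the $n$th prime in the list, it computes $p_n$ in $O((n\log n)/\log\log n)$ time. ''Asymptotically worse'' refers to the comparison of these two running time bounds. *)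

(* Defs.v *)
From Stdlib Require Import Reals.
From Coquelicot Require Import Coquelicot.

Local Open Scope R_scope.

(* Running-time bounds for computing the n-th prime, up to constant factors.
   [ln] and [/] are total, so the values at n <= 2, where log (log n) is not
   a positive real number, are junk; they do not affect the asymptotics. *)

Definition binary_search_time (n : nat) : R :=
  sqrt (INR n) * ln (INR n) ^ 4.

Definition sublinear_sieve_time (n : nat) : R :=
  INR n * ln (INR n) / ln (ln (INR n)).

(* [is_domin F f g] means g = o(f) along the filter F. *)
Definition asymptotically_worse (f g : nat -> R) : Prop :=
  is_domin eventually f g.

(* Main.v *)
Require Import Defs.
From Stdlib Require Import Reals Lra.
From Coquelicot Require Import Coquelicot.

Local Open Scope R_scope.

(** Write [L = ln n], so that [sqrt n = exp (L / 2)].  Once [L > 1], the quotient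
    of the two running times is [L ^ 3 * ln L / exp (L / 2)].  Since [ln L <= L],
    it is at most [L ^ 4 / exp (L / 2)], and since the exponential beats every
    power ([pow5_le_exp_half]), this is at most a constant over [L]
    ([binary_search_time_le]).  As [L] tends to infinity, this explicit bound
    gives the domination, and the limit of the quotient is the same fact for a
    denominator that is eventually positive. *)

(** The exponent 5 is one more than the power of the logarithm in
    [binary_search_time]: the spare factor is what tends to infinity.  The bound
    is the fifth power of [x / 10 <= exp (x / 10)]. *)
Lemma pow5_le_exp_half (x : R) : 0 <= x -> x ^ 5 <= 10 ^ 5 * exp (x / 2).
Proof.
intros Hx.
assert (Hexp : exp (x / 2) = exp (x / 10) ^ 5).
{ simpl; rewrite Rmult_1_r, <- !exp_plus; f_equal; field. }
rewrite Hexp, <- Rpow_mult_distr.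
apply pow_incr; split; [exact Hx |].
pose proof (exp_ineq1_le (x / 10)); lra.
Qed.

Lemma ln_le_self (x : R) : 0 < x -> ln x <= x.
Proof.
intros Hx; pose proof (exp_ineq1_le (ln x)) as H.
rewrite exp_ln in H by exact Hx; lra.
Qed.

Lemma sqrt_eq_exp_half_ln (x : R) : 0 < x -> sqrt x = exp (ln x / 2).
Proof.
intros Hx; apply sqrt_lem_1; [lra | left; apply exp_pos |].
rewrite <- exp_plus.
replace (ln x / 2 + ln x / 2) with (ln x) by field.
exact (exp_ln x Hx).
Qed.

Lemma is_lim_seq_ln_INR : is_lim_seq (fun n : nat => ln (INR n)) p_infty.
Proof.
exact (filterlim_comp _ _ _ INR ln _ _ _ is_lim_seq_INR is_lim_ln_p).
Qed.

Lemma eventually_ln_INR_gt (M : R) :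
  eventually (fun n : nat => 0 < INR n /\ M < ln (INR n)).
Proof.
apply filter_and.
- exists 1%nat; intros n Hn; apply lt_0_INR; exact Hn.
- apply is_lim_seq_ln_INR; exists M; auto.
Qed.

Lemma binary_search_time_ge0 (n : nat) : 0 <= binary_search_time n.
Proof.
apply Rmult_le_pos; [apply sqrt_pos |].
replace (ln (INR n) ^ 4) with ((ln (INR n) ^ 2) ^ 2) by ring.
apply pow2_ge_0.
Qed.

(** [1 < ln n] is exactly what makes the iterated logarithm positive. *)
Lemma sublinear_sieve_time_gt0 (n : nat) :
  0 < INR n -> 1 < ln (INR n) -> 0 < sublinear_sieve_time n.
Proof.
intros Hn HL; unfold sublinear_sieve_time.
apply Rdiv_lt_0_compat; [apply Rmult_lt_0_compat; lra |].
rewrite <- ln_1; apply ln_increasing; lra.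
Qed.

Lemma binary_search_time_le (n : nat) :
  0 < INR n -> 1 < ln (INR n) ->
  binary_search_time n <= 10 ^ 5 / ln (INR n) * sublinear_sieve_time n.
Proof.
intros Hn HL; unfold binary_search_time, sublinear_sieve_time.
pose proof (sqrt_eq_exp_half_ln _ Hn) as Hs.
pose proof (sqrt_sqrt _ (Rlt_le _ _ Hn)) as Hss.
pose proof (pow5_le_exp_half (ln (INR n)) ltac:(lra)) as Hpow.
rewrite <- Hs in Hpow.
assert (Hll : 0 < ln (ln (INR n))) by (rewrite <- ln_1; apply ln_increasing; lra).
pose proof (ln_le_self (ln (INR n)) ltac:(lra)) as Hle.
pose proof (sqrt_lt_R0 _ Hn) as Hs0.
set (s := sqrt (INR n)) in *.
set (L := ln (INR n)) in *.
set (l := ln L) in *.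
(* After cancelling L on the right and clearing l, the claim reads
   s * (L ^ 4 * l) <= 10 ^ 5 * s ^ 2, and L ^ 4 * l <= L ^ 5. *)
replace (10 ^ 5 / L * (INR n * L / l)) with (s * (10 ^ 5 * s) / l)
  by (rewrite <- Hss; field; lra).
apply (Rle_div_r _ _ _ Hll).
rewrite Rmult_assoc.
apply Rmult_le_compat_l; [lra |].
apply Rle_trans with (L ^ 5); [| exact Hpow].
replace (L ^ 5) with (L ^ 4 * L) by ring.
apply Rmult_le_compat_l; [apply pow_le; lra | exact Hle].
Qed.

Lemma eventually_binary_search_time_le (eps : R) : 0 < eps ->
  eventually (fun n : nat =>
    0 < sublinear_sieve_time n /\
    binary_search_time n <= eps * sublinear_sieve_time n).
Proof.
intros Heps.
generalize (eventually_ln_INR_gt (Rmax 1 (10 ^ 5 / eps))); apply filter_imp.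
intros n [Hn HM].
pose proof (Rle_lt_trans _ _ _ (Rmax_l _ _) HM) as HL.
pose proof (Rle_lt_trans _ _ _ (Rmax_r _ _) HM) as Hlarge.
pose proof (sublinear_sieve_time_gt0 n Hn HL) as Hpos.
split; [exact Hpos |].
apply Rle_trans with (1 := binary_search_time_le n Hn HL).
apply Rmult_le_compat_r; [lra |].
apply (Rle_div_l (10 ^ 5) eps (ln (INR n))); [lra |].
apply (Rlt_div_l (10 ^ 5) (ln (INR n)) eps Heps) in Hlarge; lra.
Qed.

Theorem theorem4p2 :
  asymptotically_worse sublinear_sieve_time binary_search_time /\
  is_lim_seq (fun n : nat => (binary_search_time n / sublinear_sieve_time n)%R)
             (Finite 0%R).
Proof.
split.
- intros eps.
  generalize (eventually_binary_search_time_le eps (cond_pos eps)).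
  apply filter_imp; intros n [Hpos Hle].
  change (Rabs (binary_search_time n) <= eps * Rabs (sublinear_sieve_time n)).
  rewrite !Rabs_pos_eq; [exact Hle | lra | apply binary_search_time_ge0].
- apply is_lim_seq_spec; intros eps.
  (* Halving eps turns the non-strict bound into the strict one of the limit. *)
  generalize (eventually_binary_search_time_le (eps / 2) (is_pos_div_2 eps)).
  apply filter_imp; intros n [Hpos Hle].
  rewrite Rminus_0_r, Rabs_pos_eq.
  + apply (Rlt_div_l _ _ _ Hpos).
    apply Rle_lt_trans with (1 := Hle).
    apply Rmult_lt_compat_r; [exact Hpos |].
    pose proof (cond_pos eps); lra.
  + apply Rdiv_le_0_compat; [apply binary_search_time_ge0 | exact Hpos].
Qed.
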